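(* Let $F$ be a field of characteristic zero and let $E$ be the infinite-dimensional Grassmann algebra over $F$ endowed with the $\mathbb{Z}_2$-grading induced by $\deg(\cdot)_\infty$. Then for any positive integers $d_1,\dots,d_m$, \[T_{\mathbb{Z}_2}(UT(d_1,\dots,d_m;E))=T_{\mathbb{Z}_2}(M_{d_1}(E))\cdots T_{\mathbb{Z}_2}(M_{d_m}(E)).\]
   Context: $E$ is the unitary algebra generated by $e_1,e_2,\dots$ subject to $e_ie_j=-e_je_i$ for all $i,j$; it has basis $1$ and $e_{i_1}\cdots e_{i_k}$ ($i_1<\cdots<i_k$). The grading $\deg(\cdot)_\infty$ assigns $e_i$ degree $1\in\mathbb{Z}_2$ if $i$ is odd and $0$ if $i$ is even, and $e_{i_1}\cdots e_{i_k}$ degree $\deg(e_{i_1})+\cdots+\deg(e_{i_k})$. For a $\mathbb{Z}_2$-graded algebra $R$, $T_{\mathbb{Z}_2}(R)$ is the ideal of graded polynomial identities in the free algebra $F\langle Y\cup Z\rangle$, where $Y$ (resp. $Z$) is a countable set of variables of degree $0$ (resp. $1$); products of such ideals are usual ideal products. $UT(d_1,\dots,d_m;E)$ is the algebra of block upper-triangular matrices in $M_{d_1+\cdots+d_m}(E)$ with $(r,s)$ block ($r\le s$) arbitrary $d_r\times d_s$ over $E$ and zero blocks below the diagonal; it and each $M_d(E)$ are $\mathbb{Z}_2$-graded by letting the degree-$g$ component consist of matrices all of whose entries have degree $g$. *)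

(* Defs.v *)
From mathcomp Require Import all_boot all_order all_algebra.
From mathcomp Require Import finmap.
Set Implicit Arguments. Unset Strict Implicit. Unset Printing Implicit Defensive.
Import GRing.Theory.
Local Open Scope fset_scope.
Local Open Scope ring_scope.

Section Defs.
Variable F : fieldType.

(* An element of E is given by its coordinates on the basis
   e_S = e_{i_1} ... e_{i_k} (S = {i_1 < ... < i_k} a finite subset of nat);
   genuine elements have finitely many nonzero coordinates (see [Efin]). *)
Definition Egr := {fset nat} -> F.

Definition Efin (a : Egr) : Prop :=
  exists s : seq {fset nat}, forall S, a S != 0 -> S \in s.

(* number of inversions: e_T e_U = (-1)^(inv T U) e_(T u U) for disjoint T, U *)
Definition inv (T U : {fset nat}) : nat :=
  \sum_(t <- T) size [seq u <- U | (u < t)%N].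

Definition Ezero : Egr := fun _ => 0.
Definition Eone : Egr := fun S => if S == fset0 then 1 else 0.
Definition Eadd (a b : Egr) : Egr := fun S => a S + b S.
Definition Emul (a b : Egr) : Egr := fun S =>
  \sum_(T <- fpowerset S) (-1) ^+ inv T (S `\` T) * a T * b (S `\` T).

(* deg(.)_oo : e_i has degree 1 iff i is odd; degree of e_S is the parity
   of the number of odd elements of S (Z_2 is represented by bool). *)
Definition degS (S : {fset nat}) : bool := odd (count odd S).

Definition Ehom (g : bool) (a : Egr) : Prop :=
  Efin a /\ forall S, a S != 0 -> degS S = g.

Definition mat (n : nat) := 'I_n -> 'I_n -> Egr.

Definition mat1 n : mat n := fun i j => if i == j then Eone else Ezero.
Definition matmul n (A B : mat n) : mat n :=
  fun i j S => \sum_(k < n) Emul (A i k) (B k j) S.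

(* variables: (false, k) = y_k of degree 0, (true, k) = z_k of degree 1 *)
Definition var := (bool * nat)%type.
(* a noncommutative polynomial = its coefficient function on words *)
Definition fpoly := seq var -> F.
Definition pfin (p : fpoly) : Prop :=
  exists s : seq (seq var), forall w, p w != 0 -> w \in s.
Definition padd (p q : fpoly) : fpoly := fun w => p w + q w.
Definition pmul (p q : fpoly) : fpoly := fun w =>
  \sum_(i < (size w).+1) p (take i w) * q (drop i w).

(* evaluation of a word / polynomial at a substitution phi into matrices;
   s is any list containing the support of p (the value does not depend on it) *)
Definition evalw n (phi : var -> mat n) (w : seq var) : mat n :=
  foldr (fun v M => matmul (phi v) M) (@mat1 n) w.
Definition evalp n (s : seq (seq var)) (p : fpoly) (phi : var -> mat n) : mat n :=
  fun i j S => \sum_(w <- undup s) p w * evalw phi w i j S.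

(* T_{Z2}(R) for a Z2-graded subalgebra R of M_n(E) described by its
   homogeneous components hom g (g : bool) *)
Definition gr_ids n (hom : bool -> mat n -> Prop) (p : fpoly) : Prop :=
  pfin p /\
  forall phi : var -> mat n, (forall v, hom v.1 (phi v)) ->
  forall s, (forall w, p w != 0 -> w \in s) ->
  forall i j S, evalp s p phi i j S = 0.

Definition Mhom d (g : bool) (A : mat d) : Prop := forall i j, Ehom g (A i j).

(* block index of a row/column index for block sizes ds *)
Definition blk (ds : seq nat) (i : nat) : nat :=
  count (fun r => (\sum_(s < r.+1) nth 0%N ds s <= i)%N) (iota 0 (size ds)).

Definition UThom (ds : seq nat) (g : bool) (A : mat (sumn ds)) : Prop :=
  (forall i j : 'I_(sumn ds), (blk ds j < blk ds i)%N -> forall S, A i j S = 0)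
  /\ Mhom g A.

Definition T_M d : fpoly -> Prop := gr_ids (@Mhom d).
Definition T_UT ds : fpoly -> Prop := gr_ids (@UThom ds).

Definition prodI (I J : fpoly -> Prop) : fpoly -> Prop := fun p =>
  exists k (a b : 'I_k -> fpoly), (forall r, I (a r) /\ J (b r)) /\
    forall w, p w = \sum_(r < k) pmul (a r) (b r) w.

Fixpoint prodlist (Is : seq (fpoly -> Prop)) : fpoly -> Prop :=
  match Is with
  | [::] => fun _ : fpoly => True
  | P :: rest => if rest is [::] then P else prodI P (prodlist rest)
  end.

Definition prod_T_M (ds : seq nat) : fpoly -> Prop :=
  prodlist [seq T_M d | d <- ds].

End Defs.

(* Main.v *)
Require Import Defs.
From HB Require Import structures.
From mathcomp Require Import all_boot all_order all_algebra.
From mathcomp Require Import finmap.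
From mathcomp Require Import boolp.

(* It suffices to treat one diagonal block at a time:
   T(UT(d, ds)) = T(M_d) T(UT(ds)).  The inclusion from right to left is block
   multiplication.  Conversely, let f be an identity of UT(d, ds), I = T(M_d),
   J = T(UT(ds)), and let A be the free algebra.

   Evaluating f at block matrices whose two diagonal blocks use disjoint sets of
   Grassmann generators, joined in the corner by a fresh generator, shows that
   for every variable x the tensor D_x = sum f(a x b) a (x) b vanishes in
   A/I (x) A/J, so that D_x = E_x + E'_x with E_x in I (x) A and E'_x in A (x) J.
   Since f (x) 1 - 1 (x) f = sum_x (D_x with u (x) v replaced by
   ux (x) v - u (x) xv), the tensor
     X = f (x) 1 - sum_x (E_x with the same replacement)
   lies in both I (x) A and A (x) J, hence in I (x) J; multiplication maps it to
   f, so f is in IJ. *)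

Set Implicit Arguments. Unset Strict Implicit. Unset Printing Implicit Defensive.
Import GRing.Theory.
Local Open Scope fset_scope.
Local Open Scope ring_scope.
Local Notation inv := Defs.inv.

(** * The exterior algebra as a ring *)

Section GrassmannRing.
Variable F : fieldType.
Implicit Types (S T U V : {fset nat}) (a b c : Egr F).

Lemma perm_fsetU (T : choiceType) (U V : {fset T}) :
  [disjoint U & V]%fset -> perm_eq (U `|` V) (U ++ V).
Proof.
move=> dUV; apply: uniq_perm => [||x]; last by rewrite mem_cat inE.
  exact: fset_uniq.
rewrite cat_uniq !fset_uniq andbT /=; apply/hasPn => x xV.
by apply: contraTN (dUV) => xU; apply/negP => /fdisjointP/(_ x xU); rewrite xV.
Qed.

Lemma invUl T U V : [disjoint T & U]%fset -> inv (T `|` U) V = (inv T V + inv U V)%N.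
Proof. by move=> dTU; rewrite /inv (perm_big _ (perm_fsetU dTU)) big_cat. Qed.

Lemma invUr T U V : [disjoint U & V]%fset -> inv T (U `|` V) = (inv T U + inv T V)%N.
Proof.
move=> dUV; rewrite /inv -big_split; apply: eq_bigr => t _.
by rewrite (perm_size (perm_filter _ (perm_fsetU dUV))) filter_cat size_cat.
Qed.

Lemma inv_eq0 T U : (forall t u, t \in T -> u \in U -> t <= u)%N -> inv T U = 0%N.
Proof.
move=> le_TU; rewrite /inv big_seq big1 // => t tT.
apply/eqP; rewrite size_filter -leqn0 leqNgt -has_count; apply/hasPn => u uU.
by rewrite -leqNgt le_TU.
Qed.

Lemma inv0l U : inv fset0 U = 0%N.
Proof. by apply: inv_eq0 => t u; rewrite inE. Qed.

Lemma inv0r U : inv U fset0 = 0%N.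
Proof. by apply: inv_eq0 => t u _; rewrite inE. Qed.

(** Both bracketings expand to the same sum over ordered partitions of [S] into [U], [V], [W], each
    term carrying the sign with exponent [inv U V + inv U W + inv V W]. Additivity of [inv] in each
    argument over disjoint unions gives this sign on either side. *)
Lemma EmulA : associative (@Emul F).
Proof.
move=> a b c; apply/funext => S; rewrite /Emul.
pose G U V W := (-1) ^+ (inv U V + inv U W + inv V W) * a U * b V * c W : F.
transitivity (\sum_(U <- fpowerset S) \sum_(V <- fpowerset (S `\` U))
                G U V ((S `\` U) `\` V)).
  rewrite big_seq [RHS]big_seq; apply: eq_bigr => U; rewrite fpowersetE => sUS.
  rewrite mulr_sumr big_seq [RHS]big_seq; apply: eq_bigr => V.
  rewrite fpowersetE => sVSU; rewrite /G.
  have {1}-> : S `\` U = V `|` ((S `\` U) `\` V) by rewrite fsetUDl fsetDv fsetD0; apply/esym/fsetUidPr.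
  rewrite invUr; last by apply/fdisjointP => x xV; rewrite inE xV.
  by rewrite !exprD !mulrA; congr (_ * _); rewrite -!mulrA; congr (_ * (_ * _)); rewrite mulrCA !mulrA.
transitivity (\sum_(T <- fpowerset S) \sum_(U <- fpowerset S | U `<=` T)
                G U (T `\` U) (S `\` T)); last first.
  rewrite big_seq [RHS]big_seq; apply: eq_bigr => T; rewrite fpowersetE => sTS.
  rewrite mulr_sumr mulr_suml -[LHS]big_filter.
  have pT : perm_eq [seq U <- fpowerset S | U `<=` T] (fpowerset T).
    apply: uniq_perm; rewrite ?filter_uniq ?fset_uniq // => U.
    rewrite mem_filter !fpowersetE; case: (boolP (U `<=` T)) => //= sUT.
    exact: fsubset_trans sTS.
  rewrite (perm_big _ pT) /= big_seq [RHS]big_seq; apply: eq_bigr => U; rewrite fpowersetE => sUT.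
  have -> : inv T (S `\` T) = (inv U (S `\` T) + inv (T `\` U) (S `\` T))%N.
    rewrite -invUl; last by apply/fdisjointP => x xV; rewrite inE xV.
    by congr (inv _ _); rewrite fsetUDl fsetDv fsetD0; apply/esym/fsetUidPr.
  by rewrite /G -addnA addnC exprD !mulrA.
rewrite [RHS](exchange_big_dep predT) //=.
rewrite big_seq [RHS]big_seq; apply: eq_bigr => U; rewrite fpowersetE => sUS.
rewrite -[RHS]big_filter.
(* The sets [T] between [U] and [S] are reindexed by [V = T \ U], a subset of [S \ U]. *)
have pU : perm_eq [seq T <- fpowerset S | U `<=` T]
    [seq U `|` V | V <- fpowerset (S `\` U)].
  apply: uniq_perm; rewrite ?filter_uniq ?fset_uniq //.
    rewrite map_inj_in_uniq ?fset_uniq // => V V'.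
    rewrite !fpowersetCE => /andP[_ dV] /andP[_ dV'] /(congr1 (fun X => X `\` U)).
    by rewrite !fsetDUl fsetDv !fset0U !(fsetDidPl _ _ _).
  move=> T; rewrite mem_filter fpowersetE; apply/andP/mapP => [[sUT sTS]|[V]].
    exists (T `\` U); first by rewrite fpowersetE fsetSD.
    by rewrite fsetUDl fsetDv fsetD0; apply/esym/fsetUidPr.
  by rewrite fpowersetCE => /andP[sVS _] ->; rewrite fsubsetUl fsubUset sUS.
rewrite (perm_big _ pU) big_map big_seq [RHS]big_seq; apply: eq_bigr => V.
rewrite fpowersetCE => /andP[sVS dVU].
by rewrite fsetDUl fsetDv fset0U (fsetDidPl _ _ dVU) fsetDDl.
Qed.

Lemma Emul1l : left_id (@Eone F) (@Emul F).
Proof.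
move=> a; apply/funext => S; rewrite /Emul (big_fsetD1 fset0) /=; last by rewrite fpowersetE fsub0set.
rewrite big_seq big1 ?addr0 => [|T]; last first.
  by rewrite in_fsetD1 /Eone => /andP[/negPf-> _]; rewrite mulr0 mul0r.
by rewrite /Eone eqxx inv0l expr0 !mul1r fsetD0.
Qed.

Lemma Emul1r : right_id (@Eone F) (@Emul F).
Proof.
move=> a; apply/funext => S; rewrite /Emul (big_fsetD1 S) /=; last by rewrite fpowersetE fsubset_refl.
rewrite big_seq big1 ?addr0 => [|T]; last first.
  rewrite in_fsetD1 fpowersetE /Eone => /andP[nTS sTS].
  by rewrite fsetD_eq0 ifN ?mulr0 //; apply: contra nTS => sST; rewrite eqEfsubset sTS.
by rewrite /Eone fsetDv eqxx inv0r expr0 mul1r mulr1.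
Qed.

Lemma EmulDl : left_distributive (@Emul F) (@Eadd F).
Proof.
move=> a b c; apply/funext => S; rewrite /Emul /Eadd -big_split.
by apply: eq_bigr => T _; rewrite mulrDr mulrDl.
Qed.

Lemma EmulDr : right_distributive (@Emul F) (@Eadd F).
Proof.
move=> a b c; apply/funext => S; rewrite /Emul /Eadd -big_split.
by apply: eq_bigr => T _; rewrite mulrDr.
Qed.

Lemma EaddA : associative (@Eadd F).
Proof. by move=> a b c; apply/funext => S; rewrite /Eadd addrA. Qed.

Lemma EaddC : commutative (@Eadd F).
Proof. by move=> a b; apply/funext => S; rewrite /Eadd addrC. Qed.

Lemma Eadd0l : left_id (@Ezero F) (@Eadd F).
Proof. by move=> a; apply/funext => S; rewrite /Eadd add0r. Qed.

Lemma EaddNl : left_inverse (@Ezero F) (fun a S => - a S) (@Eadd F).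
Proof. by move=> a; apply/funext => S; rewrite /Eadd addNr. Qed.

End GrassmannRing.

(* An alias, so that no pointwise structure on functions is inferred. *)
Definition grass (F : fieldType) : Type := Egr F.

HB.instance Definition _ F := gen_eqMixin (grass F).
HB.instance Definition _ F := gen_choiceMixin (grass F).
HB.instance Definition _ F := GRing.isZmodule.Build (grass F)
  (@EaddA F) (@EaddC F) (@Eadd0l F) (@EaddNl F).
HB.instance Definition _ F := GRing.Zmodule_isPzRing.Build (grass F)
  (@EmulA F) (@Emul1l F) (@Emul1r F) (@EmulDl F) (@EmulDr F).

(** * Matrices over the Grassmann ring *)

Section Grass.
Variable F : fieldType.
Local Notation E := (grass F).

Lemma grass0E S : (0 : E) S = 0. Proof. by []. Qed.
Lemma grassBE (a b : E) S : (a - b) S = a S - b S. Proof. by []. Qed.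
Lemma grassME (a b : E) S : (a * b) S =
  \sum_(T <- fpowerset S) (-1) ^+ inv T (S `\` T) * a T * b (S `\` T).
Proof. by []. Qed.

Lemma grass_sumE (I : Type) (r : seq I) (P : pred I) (G : I -> E) S :
  (\sum_(i <- r | P i) G i) S = \sum_(i <- r | P i) G i S.
Proof. by elim/big_rec2: _ => // i x y _ <-. Qed.

Definition tomx n (A : mat F n) : 'M[E]_n := \matrix_(i, j) (A i j : E).
Definition ofmx n (A : 'M[E]_n) : mat F n := fun i j => A i j.

Lemma tomxK n : cancel (@tomx n) (@ofmx n).
Proof. by move=> A; do 2!apply/funext => ?; rewrite /ofmx mxE. Qed.

Lemma ofmxK n : cancel (@ofmx n) (@tomx n).
Proof. by move=> A; apply/matrixP => i j; rewrite mxE. Qed.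

Lemma evalwE n (phi : var -> mat F n) w i j S :
  evalw phi w i j S = (\prod_(v <- w) tomx (phi v)) i j S.
Proof.
suff -> : evalw phi w = ofmx (\prod_(v <- w) tomx (phi v)) by [].
elim: w => [|v w IH] /=; do 2!apply/funext => ?; apply/funext => U.
  by rewrite big_nil /mat1 /ofmx /GRing.one /= mxE; case: eqP.
rewrite big_cons IH /matmul /ofmx /GRing.mul /= mxE grass_sumE.
by apply: eq_bigr => k _; rewrite mxE.
Qed.

End Grass.

(** * Lewin's theorem on products of ideals *)

Section Lewin.
Variable F : fieldType.
Local Notation word := (seq var).
Implicit Types (L M : (word -> F) -> Prop) (p q f : fpoly F).

Lemma sum_supp (T : eqType) (s t : seq T) (h : T -> F) :
    uniq s -> uniq t ->
    (forall w, h w != 0 -> w \in s) -> (forall w, h w != 0 -> w \in t) ->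
  \sum_(w <- s) h w = \sum_(w <- t) h w.
Proof.
move=> us ut hs ht.
have nz r : \sum_(w <- r) h w = \sum_(w <- [seq w <- r | h w != 0]) h w.
  by rewrite big_filter [RHS]big_mkcond; apply: eq_bigr => w _; case: eqP.
rewrite nz [RHS]nz; apply: perm_big; apply: uniq_perm; rewrite ?filter_uniq //.
move=> w; rewrite !mem_filter; case: (boolP (h w != 0)) => //= hw.
by rewrite hs // ht.
Qed.

(** The orthogonal of a set of linear functionals on the free algebra, a functional being given by
    its values on words. Ideals of identities take this form, so membership in tensor products of
    ideals reduces to linear duality. *)
Definition ann L p : Prop :=
  pfin p /\ forall l, L l -> forall s, (forall w, p w != 0 -> w \in s) ->
    \sum_(w <- undup s) p w * l w = 0.

Lemma annP L p s : uniq s -> (forall w, p w != 0 -> w \in s) ->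
  ann L p <-> forall l, L l -> \sum_(w <- s) p w * l w = 0.
Proof.
have pl l r w : (forall w, p w != 0 -> w \in r) -> p w * l w != 0 -> w \in r.
  by move=> ps; rewrite mulf_eq0 negb_or => /andP[/ps].
move=> us ps; split=> [[_ pL] l /pL/(_ s ps)|pL]; first by rewrite undup_id.
split=> [|l Ll t pt]; first by exists s.
rewrite -[RHS](pL l Ll); apply: sum_supp => // [|w|w]; first exact: undup_uniq.
- by move/pl; apply=> w' pw'; rewrite mem_undup pt.
- exact: pl.
Qed.

Lemma ann0 L : ann L (fun=> 0).
Proof.
apply/(@annP _ _ [::]) => // [w|l _]; first by rewrite eqxx.
by rewrite big_nil.
Qed.

Lemma ann_lin L c p q : ann L p -> ann L q -> ann L (fun w => p w + c * q w).
Proof.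
move=> [[s ps] Lp] [[t qt] Lq].
have pst w : p w != 0 -> w \in s ++ t by move=> /ps; rewrite mem_cat => ->.
have qst w : q w != 0 -> w \in s ++ t by move=> /qt; rewrite mem_cat orbC => ->.
apply/(@annP _ _ (undup (s ++ t))) => [|w|l Ll]; first exact: undup_uniq.
  rewrite mem_undup; have [pw0|/pst//] := eqVneq (p w) 0.
  by rewrite pw0 add0r mulf_eq0 negb_or => /andP[_ /qst].
rewrite (eq_bigr (fun w => p w * l w + c * (q w * l w))).
  by rewrite big_split /= -mulr_sumr Lp // Lq // mulr0 addr0.
by move=> w _; rewrite mulrDl mulrA.
Qed.

Lemma ann_add L p q : ann L p -> ann L q -> ann L (fun w => p w + q w).
Proof.
move=> Lp Lq; suff -> : (fun w => p w + q w) = (fun w => p w + 1 * q w).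
  exact: ann_lin.
by apply/funext => w; rewrite mul1r.
Qed.

Lemma ann_opp L p : ann L p -> ann L (fun w => - p w).
Proof.
move=> Lp; suff -> : (fun w => - p w) = (fun w => (fun=> 0) w + -1 * p w).
  exact: ann_lin (ann0 L) Lp.
by apply/funext => w; rewrite add0r mulN1r.
Qed.

(* Gaussian elimination: subtracting the rank one tensor through a nonzero
   entry kills a row while keeping the columns in [I] and the rows in [J]. *)
Lemma tensor_sum (I J : fpoly F -> Prop) (s : seq word) (X : word -> fpoly F) :
    (forall c p q, I p -> I q -> I (fun w => p w + c * q w)) ->
    (forall c p q, J p -> J q -> J (fun w => p w + c * q w)) ->
    (forall a b, X a b != 0 -> a \in s) ->
    (forall b, I (X^~ b)) -> (forall a, J (X a)) ->
  exists k (u v : 'I_k -> fpoly F), (forall r, I (u r) /\ J (v r)) /\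
    forall a b, X a b = \sum_(r < k) u r a * v r b.
Proof.
move=> linI linJ; elim: s X => [|a0 s IH] X Xs XI XJ.
  exists 0%N, (fun=> fun=> 0), (fun=> fun=> 0); split=> [[]//|a b].
  by rewrite big_ord0; apply/eqP/negP => /negP/Xs.
have [[b0 Xnz]|X0] := pselect (exists b, X a0 b != 0); last first.
  apply: IH => // a b /[dup] Xab /Xs; rewrite inE => /predU1P[a_a0|//].
  by case: X0; exists b; rewrite -a_a0.
pose X' a b := X a b - X a b0 / X a0 b0 * X a0 b.
have [|b|a|k [u [v [uv Xuv]]]] := IH X'.
- move=> a b X'nz; have : (a \in a0 :: s) && (a != a0).
    apply/andP; split.
      apply: contraNT X'nz => as0; rewrite /X'.
      have X0 c : X a c = 0 by apply: contraNeq as0; apply: Xs.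
      by rewrite !X0 !mul0r subrr.
    by apply: contraNneq X'nz => ->; rewrite /X' divff // mul1r subrr.
  by rewrite inE => /andP[/predU1P[->|//]]; rewrite eqxx.
- suff -> : X'^~ b = (fun a => X a b + (- X a0 b / X a0 b0) * X a b0) by exact: linI.
  by apply/funext => a; rewrite /X' !mulNr -mulrA mulrC [X a0 b / _]mulrC.
- suff -> : X' a = (fun b => X a b + (- (X a b0 / X a0 b0)) * X a0 b) by exact: linJ.
  by apply/funext => b; rewrite /X' mulNr.
exists k.+1.
exists (fun r => if unlift ord0 r is Some i then u i else X^~ b0).
(* Closure is assumed only in the form [p + c q], so the multiple [c p] is obtained as
   [p + (c - 1) p]. *)
have Jv : J (fun b => X a0 b / X a0 b0).
  suff -> : (fun b => X a0 b / X a0 b0) = fun b => X a0 b + ((X a0 b0)^-1 - 1) * X a0 b.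
    exact: linJ.
  by apply/funext => b; rewrite mulrBl mul1r addrC subrK mulrC.
exists (fun r => if unlift ord0 r is Some i then v i else fun b => X a0 b / X a0 b0).
split=> [r|a b]; first by case: unliftP.
rewrite big_ord_recl unlift_none; under eq_bigr do rewrite liftK.
by rewrite -Xuv /X' mulrA mulrAC addrC subrK.
Qed.

(** Duality: a finite tensor killed by every [l (x) m] lies in [ann L (x) A + A (x) ann M], where
    [A] is the free algebra. The induction removes one row of [D] at a time; [s] stays fixed because
    the pairing sums over it, while [r] shrinks. *)
Lemma tensor_split L M (s t : seq word) (r : seq word) (D : word -> fpoly F) :
    uniq s -> uniq t -> {subset r <= s} ->
    (forall a b, D a b != 0 -> a \in r /\ b \in t) ->
    (forall l m, L l -> M m ->
       \sum_(a <- s) \sum_(b <- t) D a b * l a * m b = 0) ->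
  exists E : word -> fpoly F,
    [/\ forall a b, E a b != 0 -> a \in s /\ b \in t,
        forall b, ann L (E^~ b) & forall a, ann M (fun b => D a b - E a b)].
Proof.
move=> us ut; elim: r D => [|a0 r IH] D rs Drt LDM.
  exists (fun=> fun=> 0); split=> [a b|b|a]; rewrite ?eqxx //; first exact: ann0.
  suff -> : (fun b => D a b - 0) = fun=> 0 by exact: ann0.
  by apply/funext => b; rewrite subr0; apply/eqP/negP => /negP/Drt[].
have rs' : {subset r <= s} by move=> a ar; apply: rs; rewrite inE ar orbT.
have Dt a b : D a b != 0 -> b \in t by case/Drt.
have Ds a b : D a b != 0 -> a \in s by case/Drt => /rs.
have [Ma0|nMa0] := pselect (ann M (D a0)).
  (* A row in [ann M] pairs to zero with every [m], so it can be erased and left to the [ann M]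
     part. *)
  pose D' a b := if a == a0 then 0 else D a b.
  have [a b||E [Est LE ME]] := IH D' rs'.
  - rewrite /D'; case: ifP => [_|a_a0 /Drt[]]; first by rewrite eqxx.
    by rewrite inE a_a0.
  - move=> l m Ll Mm; rewrite -[RHS](LDM l m Ll Mm); apply: eq_bigr => a _.
    rewrite /D'; case: eqP => [->|//].
    rewrite big1 => [|b _]; last by rewrite !mul0r.
    transitivity (l a0 * \sum_(b <- t) D a0 b * m b).
      by rewrite (annP M ut (@Dt a0)).1 // mulr0.
    by rewrite mulr_sumr; apply: eq_bigr => b _; rewrite mulrCA mulrA.
  exists E; split=> // a; have := ME a; rewrite /D'; case: eqP => [-> ME0|//].
  suff -> : (fun b => D a0 b - E a0 b) = fun b => D a0 b + (0 - E a0 b).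
    exact: ann_add.
  by apply/funext => b; rewrite sub0r.
have [m Mm nz] : exists2 m, M m & \sum_(b <- t) D a0 b * m b != 0.
  apply: contrapT => nm; apply: nMa0; apply/(annP M ut (@Dt a0)) => m Mm.
  by apply/eqP/negP => /negP nz; apply: nm; exists m.
(* Contracting [D] with [m] gives an element of [ann L] that is nonzero at [a0]. *)
pose u a := \sum_(b <- t) D a b * m b.
have us' a : u a != 0 -> a \in s.
  apply: contraNT => as0; rewrite /u big1 // => b _.
  by rewrite (_ : D a b = 0) ?mul0r //; apply: contraNeq as0; apply: Ds.
have Lu : ann L u.
  apply/(annP L us us') => l Ll; rewrite -[RHS](LDM l m Ll Mm).
  apply: eq_bigr => a _; rewrite mulr_suml; apply: eq_bigr => b _.
  by rewrite mulrAC.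
(* The subtracted rank one tensor has its columns in [ann L]. It clears row [a0] and leaves the rows
   outside [a0 :: r] at zero, since [u] vanishes there. *)
pose D' a b := D a b - u a / u a0 * D a0 b.
have [a b D'nz||E [Est LE ME]] := IH D' rs'.
- have [Dab0|Dab] := eqVneq (D a b) 0.
    move: (D'nz); rewrite /D' Dab0 sub0r oppr_eq0 mulf_eq0 negb_or.
    case/andP=> ua /Dt bt; split=> //.
    have : a \in a0 :: r.
      apply: contraNT ua => ar; rewrite /u big1 ?mul0r // => c _.
      by rewrite (_ : D a c = 0) ?mul0r //; apply: contraNeq ar => /Drt[].
    rewrite inE => /predU1P[a_a0|//]; move: D'nz.
    by rewrite /D' a_a0 divff // mul1r subrr eqxx.
  have [] := Drt _ _ Dab; rewrite inE => /predU1P[a_a0|//]; move: D'nz.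
  by rewrite /D' a_a0 divff // mul1r subrr eqxx.
- move=> l m' Ll Mm'; transitivity
    (\sum_(a <- s) \sum_(b <- t) D a b * l a * m' b -
     (\sum_(a <- s) u a * l a) * (\sum_(b <- t) D a0 b / u a0 * m' b)).
    rewrite mulr_suml -sumrB; apply: eq_bigr => a _.
    rewrite mulr_sumr -sumrB; apply: eq_bigr => b _.
    rewrite /D' !mulrBl; congr (_ - _); rewrite -!mulrA; congr (_ * _).
    by rewrite [LHS]mulrCA [RHS]mulrCA; congr (_ * _); rewrite [LHS]mulrCA.
  by rewrite LDM // ((annP L us us').1 Lu) // mul0r subrr.
exists (fun a b => E a b + D a0 b / u a0 * u a); split=> [a b|b|a].
- have [Eab0|/Est//] := eqVneq (E a b) 0.
  rewrite Eab0 add0r !mulf_eq0 !negb_or => /andP[/andP[Da0b _] ua].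
  by split; [exact: us'|exact: Dt Da0b].
- exact: ann_lin.
suff -> : (fun b => D a b - (E a b + D a0 b / u a0 * u a)) = fun b => D' a b - E a b.
  exact: ME.
apply/funext => b; rewrite /D' opprD addrA addrAC; congr (_ - _ - _).
by rewrite [LHS]mulrC mulrA mulrAC.
Qed.

(** For a family of polynomials [G x], this is the sum of the products [G x] times [x], and
    [on_head] is the sum of the products [x] times [G x]. They carry out the replacements of
    [u (x) v] by [ux (x) v] and by [u (x) xv]. *)
Definition on_last (G : var -> word -> F) (w : word) : F :=
  if w is v :: w' then G (last v w') (belast v w') else 0.

Definition on_head (G : var -> word -> F) (w : word) : F :=
  if w is v :: w' then G v w' else 0.

Lemma on_last_rcons G a x : on_last G (rcons a x) = G x a.
Proof. by case: a => //= v a; rewrite last_rcons belast_rcons. Qed.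

(** Says that [ann L] is stable under right multiplication by variables; [lstable] is the left
    analogue. Only these one-sided properties enter the splitting argument. *)
Definition rstable L := forall l x p s, L l -> ann L p -> uniq s ->
  (forall w, p w != 0 -> w \in s) -> \sum_(w <- s) p w * l (rcons w x) = 0.

Definition lstable L := forall l x p s, L l -> ann L p -> uniq s ->
  (forall w, p w != 0 -> w \in s) -> \sum_(w <- s) p w * l (x :: w) = 0.

Lemma ann_on_last L (V : seq var) (s : seq word) G : rstable L -> uniq V -> uniq s ->
    (forall x a, G x a != 0 -> x \in V /\ a \in s) -> (forall x, ann L (G x)) ->
  ann L (on_last G).
Proof.
move=> stL uV us GVs LG.
apply/(@annP _ _ [seq rcons a x | x <- V, a <- s]).
- apply: allpairs_uniq => // -[x a] [y b] _ _ /= /rcons_inj[-> ->//].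
- elim/last_ind=> [|a x _]; first by rewrite eqxx.
  by rewrite on_last_rcons => /GVs[xV aS]; apply/allpairsP; exists (x, a).
move=> l Ll; rewrite big_allpairs_dep big1 // => x _.
rewrite -[RHS](stL l x (G x) s Ll (LG x) us).
  by apply: eq_bigr => a _; rewrite on_last_rcons.
by move=> a /GVs[].
Qed.

Lemma ann_on_head L (V : seq var) (s : seq word) G : lstable L -> uniq V -> uniq s ->
    (forall x a, G x a != 0 -> x \in V /\ a \in s) -> (forall x, ann L (G x)) ->
  ann L (on_head G).
Proof.
move=> stL uV us GVs LG.
apply/(@annP _ _ [seq x :: a | x <- V, a <- s]).
- by apply: allpairs_uniq => // -[x a] [y b] _ _ /= [-> ->].
- case=> [|x a] /=; first by rewrite eqxx.
  by move=> /GVs[xV aS]; apply/allpairsP; exists (x, a).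
move=> l Ll; rewrite big_allpairs_dep big1 // => x _.
by rewrite -[RHS](stL l x (G x) s Ll (LG x) us) // => a /GVs[].
Qed.

(** The last hypothesis says that the tensor [D_x], whose coordinate at [(a, b)] is the coefficient
    of [f] at [a x b], is killed by all [l (x) m]. *)
Theorem lewin L M f : rstable L -> lstable M -> ann L f -> ann M f ->
    (forall x l m (s t : seq word), L l -> M m -> uniq s -> uniq t ->
       (forall a b, f (a ++ x :: b) != 0 -> a \in s /\ b \in t) ->
       \sum_(a <- s) \sum_(b <- t) f (a ++ x :: b) * l a * m b = 0) ->
  prodI (ann L) (ann M) f.
Proof.
move=> stL stM Lf Mf LfM; have [[s0 fs0] _] := Lf.
(* [V] contains all variables of [f], and [s] all prefixes and suffixes of its words; every tensor
   below is supported on these finite lists. *)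
pose V := undup (flatten s0).
pose s := undup (flatten [seq [seq take i w | i <- iota 0 (size w).+1] ++
                              [seq drop i w | i <- iota 0 (size w).+1] | w <- s0]).
have us : uniq s by exact: undup_uniq.
have uV : uniq V by exact: undup_uniq.
have fV a x b : f (a ++ x :: b) != 0 -> x \in V.
  move=> /fs0 ws; rewrite mem_undup; apply/flattenP; exists (a ++ x :: b) => //.
  by rewrite mem_cat inE eqxx orbT.
have fs a b : f (a ++ b) != 0 -> a \in s /\ b \in s.
  move=> /fs0 ws; rewrite !mem_undup; split; apply/flattenP;
    (eexists; first by apply/mapP; exists (a ++ b));
    rewrite mem_cat; apply/orP; [left|right]; apply/mapP; exists (size a);
    by rewrite ?mem_iota ?size_cat ?leq0n ?ltnS ?leq_addr ?take_size_cat ?drop_size_cat.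
have fxs a x b : f (a ++ x :: b) != 0 -> a \in s /\ b \in s.
  move=> /[dup] /fs[-> _]; rewrite -cat_rcons => /fs[_ ->//].
have /boolp.choice[E EP] x : exists E : word -> fpoly F,
    [/\ forall a b, E a b != 0 -> [/\ x \in V, a \in s & b \in s],
        forall b, ann L (fun a => E a b) &
        forall a, ann M (fun b => f (a ++ x :: b) - E a b)].
  have [xV|xV] := boolP (x \in V); last first.
    exists (fun=> fun=> 0); split=> [a b|b|a]; rewrite ?eqxx //; first exact: ann0.
    suff -> : (fun b => f (a ++ x :: b) - 0) = fun=> 0 by exact: ann0.
    by apply/funext => b; rewrite subr0; apply: contraNeq xV => /fV.
  have [|||E [Es LE ME]] := @tensor_split L M s s s (fun a b => f (a ++ x :: b)) us us.
  - by [].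
  - by move=> a b /fxs.
  - by move=> l m Ll Mm; apply: LfM => // a b /fxs.
  by exists E; split=> // a b /Es[].
(* This is the part of [D_x] lying in [A (x) ann M], with [A] the free algebra. *)
pose D x a b := f (a ++ x :: b) - E x a b.
have DVs x a b : D x a b != 0 -> [/\ x \in V, a \in s & b \in s].
  have [E0|Enz _] := eqVneq (E x a b) 0; last by case: (EP x) => /(_ a b Enz).
  by rewrite /D E0 subr0 => nz; have [? ?] := fxs _ _ _ nz; rewrite (fV _ _ _ nz).
(* This expression shows the columns of [X] to lie in [ann L]. *)
pose X a b := (if b is [::] then f a else 0) - on_last (fun x a' => E x a' b) a
              + on_head (fun x b' => E x a b') b.
(* The telescoping identity for [f (x) 1 - 1 (x) f] rewrites [X] in terms of the complementary
   parts, which shows its rows to lie in [ann M]. *)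
have XE a b : X a b = (if a is [::] then f b else 0) + on_last (fun x a' => D x a' b) a
              - on_head (fun x b' => D x a b') b.
  rewrite /X /D; elim/last_ind: a => [|a x _].
    by case: b => [|y b] /=; rewrite ?subr0 ?addr0 // opprB add0r addrCA subrr addr0.
  rewrite !on_last_rcons.
  have -> : (if rcons a x is [::] then f b else 0) = 0 by case: (a).
  case: b => [|y b] /=; first by rewrite subr0 addr0 add0r cats1.
  by rewrite cat_rcons !add0r opprB addrC [in RHS]addrC addrA addrNK.
have [|||||k [u [v [uv Xuv]]]] := @tensor_sum (ann L) (ann M)
    (s ++ [seq rcons a x | x <- V, a <- s]) X.
- exact: ann_lin.
- exact: ann_lin.
- move=> a b; apply: contraNT; rewrite mem_cat negb_or => /andP[as0 aVs].
  have E0 x c : E x a c = 0 by apply: contraNeq as0; case: (EP x) => + _ _ => /[apply] -[].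
  have f0 : f a = 0 by apply: contraNeq as0; rewrite -[a in f a]cats0 => /fs[].
  rewrite /X f0 (_ : on_head _ _ = 0) ?addr0; last by case: b.
  rewrite (_ : on_last _ _ = 0) ?subr0; first by case: b.
  elim/last_ind: a as0 aVs {E0 f0} => // a x _ _ aVs.
  rewrite on_last_rcons; apply: contraNeq aVs; case: (EP x) => + _ _ => /[apply] -[xV aS _].
  by apply/allpairsP; exists (x, a).
- move=> b; apply: ann_add; first apply: ann_add.
  + by case: b => [|y b]; [exact: Lf|exact: ann0].
  + apply: ann_opp; apply: (@ann_on_last _ V s) => // [x a|x]; case: (EP x) => //.
    by move=> + _ _ => /[apply] -[].
  + by case: b => [|y b] /=; [exact: ann0|case: (EP y)].
- move=> a; suff -> : X a = fun b => (if a is [::] then f b else 0)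
      + on_last (fun x a' => D x a' b) a + - on_head (fun x b' => D x a b') b.
    apply: ann_add; first apply: ann_add.
    + by case: a => [|y a]; [exact: Mf|exact: ann0].
    + case: a => [|y a] /=; first exact: ann0.
      by case: (EP (last y a)) => _ _; apply.
    + apply: ann_opp; apply: (@ann_on_head _ V s) => // [x b /DVs[]//|x].
      by case: (EP x) => _ _; apply.
  by apply/funext => b; rewrite XE.
exists k, u, v; split=> // w.
(* Multiplying out [X] sums its coordinates over all cuts of [w]. The term [f (x) 1] contributes
   only at the last cut, where it gives [f w]. *)
transitivity (\sum_(i < (size w).+1) X (take i w) (drop i w)); last first.
  rewrite /pmul exchange_big; apply: eq_bigr => i _; exact: Xuv.
rewrite /X big_split sumrB /=.
rewrite big_ord_recr /= drop_size take_size big1 ?add0r; last first.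
  move=> i _; case: (drop i w) (size_drop i w) => [|//] /= /esym/eqP.
  by rewrite subn_eq0 leqNgt ltn_ord.
(* [on_last] vanishes at the first cut and [on_head] at the last. The remaining terms cancel:
   [on_last] at cut [i + 1] and [on_head] at cut [i] both read [E x] on the two sides of the letter
   [x] at position [i]. *)
rewrite big_ord_recl take0 /= add0r big_ord_recr /= drop_size addr0.
rewrite -[LHS]addr0 -addrA; congr (_ + _); apply/esym.
apply/eqP; rewrite addrC subr_eq0; apply/eqP; apply: eq_bigr => i _.
have x0 : var := (false, 0%N).
rewrite (drop_nth x0) ?ltn_ord //= /bump /= add1n (take_nth x0) ?ltn_ord //.
by rewrite on_last_rcons.
Qed.

End Lewin.

(** * Truncation and shift of the generators *)

Section GrassmannMorphisms.
Variable F : fieldType.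
Local Notation E := (grass F).
Implicit Types (S T U : {fset nat}) (a b c : E).

Lemma fsub_all (P : pred nat) S T : T `<=` S -> all P S -> all P T.
Proof. by move=> /fsubsetP sTS /allP PS; apply/allP => x /sTS/PS. Qed.

Lemma all_fsetD (P : pred nat) S T : all P T -> all P (S `\` T) -> all P S.
Proof.
move=> /allP PT /allP PST; apply/allP => x xS.
by have [/PT//|xT] := boolP (x \in T); apply: PST; rewrite inE xT.
Qed.

Definition high N a := forall S, a S != 0 -> all (leq N) S.

Lemma grass_mul_eq0 a b S :
  (forall T, T `<=` S -> a T != 0 -> b (S `\` T) != 0 -> False) -> (a * b) S = 0.
Proof.
move=> abS; rewrite grassME big_seq big1 // => T; rewrite fpowersetE => sTS.
have [->|aT] := eqVneq (a T) 0; first by rewrite mulr0 mul0r.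
have [->|bST] := eqVneq (b (S `\` T)) 0; first by rewrite mulr0.
by case: (abS T).
Qed.

Lemma highM N a b : high N a -> high N b -> high N (a * b).
Proof.
move=> Na Nb S; apply: contraNT => nS; apply/eqP/grass_mul_eq0 => T _ /Na NT /Nb NST.
by move: nS; rewrite (all_fsetD NT NST).
Qed.

(* No sign appears since all generators of [a] precede those of [c]. *)
Lemma grass_mul_low_high N a c S U :
    (forall T, a T != 0 -> all (fun x => x < N)%N T) -> high N c ->
    all (fun x => x < N)%N S -> all (leq N) U ->
  (a * c) (S `|` U) = a S * c U.
Proof.
move=> Na Nc /allP NS /allP NU.
have SU : (S `|` U) `\` S = U.
  apply/fsetP => x; rewrite !inE; case: (boolP (x \in S)) => //= /NS xN.
  by apply/esym/negP => /NU; rewrite leqNgt xN.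
rewrite grassME (big_fsetD1 S) /=; last by rewrite fpowersetE fsubsetUl.
rewrite SU inv_eq0 ?expr0 ?mul1r => [|t u /NS tN /NU uN]; last exact: leq_trans (ltnW tN) uN.
(* A contributing [T] lies below [N], hence inside [S]; its complement lies at or above [N], hence
   [T] contains [S]. *)
rewrite big_seq big1 ?addr0 // => T; rewrite in_fsetD1 fpowersetE => /andP[nTS sT].
have [->|/Na/allP NT] := eqVneq (a T) 0; first by rewrite mulr0 mul0r.
have [->|/Nc/allP NSUT] := eqVneq (c ((S `|` U) `\` T)) 0; first by rewrite mulr0.
case/negP: nTS; rewrite eqEfsubset; apply/andP; split; apply/fsubsetP => x.
  move=> xT; have := fsubsetP sT x xT; rewrite inE => /orP[//|/NU].
  by rewrite leqNgt NT.
move=> xS; apply: contraTT (NS x xS) => xT; rewrite -leqNgt; apply: NSUT.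
by rewrite !inE xT xS.
Qed.

Definition egen n : E := fun S => if S == [fset n] then 1 else 0.

Lemma egenE n : egen n [fset n] = 1. Proof. by rewrite /egen eqxx. Qed.

Lemma egen_supp n S : egen n S != 0 -> S = [fset n].
Proof. by rewrite /egen; case: ifP => [/eqP//|_] /eqP. Qed.

Lemma Ehom_egen n : Ehom (odd n) (egen n).
Proof.
split=> [|S /egen_supp ->]; first by exists [:: [fset n]] => S /egen_supp ->; rewrite inE.
have pn : perm_eq [fset n] [:: n] by apply: uniq_perm => // x; rewrite !inE.
by rewrite /degS (permP pn) /= addn0 oddb.
Qed.

Lemma Ehom0 g : Ehom g (0 : E).
Proof. by split=> [|S]; [exists [::] => S|]; rewrite grass0E eqxx. Qed.

(** The algebra endomorphism that kills the generators of index at least [N] and fixes the others.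
    It preserves degrees, so it turns graded substitutions into graded substitutions. *)
Definition trunc N a : E := fun S => if all (fun x => x < N)%N S then a S else 0.

Lemma truncB N : zmod_morphism (trunc N).
Proof.
move=> a b; apply/funext => S; rewrite grassBE /trunc grassBE.
by case: ifP => // _; rewrite subrr.
Qed.

Lemma truncM N : monoid_morphism (trunc N).
Proof.
split=> [|a b]; apply/funext => S; rewrite /trunc.
  by case: ifP => // nS; rewrite /GRing.one /= /Eone; case: eqP nS => // ->.
case: ifP => [NS|nS].
  rewrite !grassME big_seq [RHS]big_seq; apply: eq_bigr => T; rewrite fpowersetE => sTS.
  by rewrite (fsub_all sTS NS) (fsub_all _ NS) ?fsubsetDl.
apply/esym/grass_mul_eq0 => T _; case: ifP => [NT _|]; last by rewrite eqxx.
by case: ifP => [NST|]; rewrite ?eqxx // (all_fsetD NT NST) in nS *.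
Qed.

HB.instance Definition _ N := GRing.isZmodMorphism.Build E E (trunc N) (truncB N).
HB.instance Definition _ N := GRing.isMonoidMorphism.Build E E (trunc N) (truncM N).

Lemma trunc_low N a S : trunc N a S != 0 -> all (fun x => x < N)%N S.
Proof. by rewrite /trunc; case: ifP; rewrite ?eqxx. Qed.

Lemma Ehom_trunc N g a : Ehom g a -> Ehom g (trunc N a).
Proof.
have tr S : trunc N a S != 0 -> a S != 0 by rewrite /trunc; case: ifP; rewrite ?eqxx.
by move=> [[s as_] ag]; split=> [|S /tr/ag//]; exists s => S /tr/as_.
Qed.

Definition up N S : {fset nat} := [fset (x + N)%N | x in S].
Definition down N S : {fset nat} := [fset (x - N)%N | x in S].

Lemma perm_up N S : perm_eq (up N S) [seq (x + N)%N | x <- S].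
Proof. by apply: enum_imfset => x y _ _; apply: addIn. Qed.

Lemma all_up N S : all (leq N) (up N S).
Proof. by rewrite (perm_all _ (perm_up N S)) all_map; apply/allP => x _ /=; rewrite leq_addl. Qed.

Lemma upK N S : down N (up N S) = S.
Proof.
apply/fsetP => x; apply/imfsetP/idP => [[y /= /imfsetP[z /= zS ->] ->]|xS].
  by rewrite addnK.
by exists (x + N)%N; rewrite ?addnK //; apply/imfsetP; exists x.
Qed.

Lemma downK N S : all (leq N) S -> up N (down N S) = S.
Proof.
move=> /allP NS; apply/fsetP => x; apply/imfsetP/idP => [[y /= /imfsetP[z /= zS ->] ->]|xS].
  by rewrite subnK // NS.
by exists (x - N)%N; rewrite ?subnK ?NS //; apply/imfsetP; exists x.
Qed.

Lemma mem_up N S x : ((x + N)%N \in up N S) = (x \in S).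
Proof. by rewrite (perm_mem (perm_up N S)) (mem_map (@addIn N)). Qed.

Lemma upD N S T : up N S `\` up N T = up N (S `\` T).
Proof.
apply/fsetP => x; rewrite inE; have [Nx|Nx] := leqP N x.
  by rewrite -(subnK Nx) !mem_up inE.
have out U : (x \in up N U) = false.
  by apply/negP => /(allP (all_up N U)); rewrite leqNgt Nx.
by rewrite !out andbF.
Qed.

Lemma inv_up N S T : inv (up N S) (up N T) = inv S T.
Proof.
rewrite /inv (perm_big _ (perm_up N S)) big_map; apply: eq_bigr => s _.
rewrite (perm_size (perm_filter _ (perm_up N T))) filter_map size_map.
by congr size; apply: eq_filter => t /=; rewrite ltn_add2r.
Qed.

(** The algebra endomorphism sending each generator [e_n] to [e_(n+N)]. The guard keeps the
    truncated subtraction in [down] exact. *)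
Definition shift N a : E := fun S => if all (leq N) S then a (down N S) else 0.

Lemma shift_up N a S : shift N a (up N S) = a S.
Proof. by rewrite /shift all_up upK. Qed.

Lemma shift_high N a : high N (shift N a).
Proof. by move=> S; rewrite /shift; case: ifP; rewrite ?eqxx. Qed.

Lemma shiftB N : zmod_morphism (shift N).
Proof.
move=> a b; apply/funext => S; rewrite grassBE /shift grassBE.
by case: ifP => // _; rewrite subrr.
Qed.

(** Translation preserves the order of indices, hence all inversion counts, and the subsets of a
    translated set are the translates of its subsets. *)
Lemma shiftM N : monoid_morphism (shift N).
Proof.
split=> [|a b]; apply/funext => S.
  have [NS|nS] := boolP (all (leq N) S).
    rewrite -(downK NS) shift_up /GRing.one /= /Eone; congr (if _ then _ else _).
    have up0 : up N fset0 = fset0 by apply: imfset0.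
    by rewrite -[in RHS]up0 (can_eq (upK N)).
  rewrite /shift (negPf nS) /GRing.one /= /Eone; case: eqP nS => // -> /allP[] x.
  by rewrite inE.
have [NS|nS] := boolP (all (leq N) S); last first.
  rewrite {1}/shift (negPf nS); apply/esym/grass_mul_eq0 => T _ /shift_high NT /shift_high NST.
  by rewrite (all_fsetD NT NST) in nS.
rewrite -(downK NS) shift_up; set S0 := down N S; rewrite !grassME.
have pS : perm_eq (fpowerset (up N S0)) [seq up N T | T <- fpowerset S0].
  apply: uniq_perm; rewrite ?fset_uniq //.
    by rewrite map_inj_uniq ?fset_uniq //; apply: can_inj (upK N).
  move=> T; rewrite fpowersetE; apply/idP/mapP => [sT|[T0]].
    have NT := fsub_all sT (all_up N S0); exists (down N T); last by rewrite downK.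
    rewrite fpowersetE; apply/fsubsetP => x; rewrite -(mem_up N) downK // => /(fsubsetP sT).
    by rewrite mem_up.
  rewrite fpowersetE => sT ->; apply/fsubsetP => x /[dup] /(allP (all_up N T0)) Nx.
  by rewrite -(subnK Nx) !mem_up => /(fsubsetP sT).
rewrite (perm_big _ pS) big_map; apply: eq_bigr => T _.
by rewrite upD inv_up !shift_up.
Qed.

HB.instance Definition _ N := GRing.isZmodMorphism.Build E E (shift N) (shiftB N).
HB.instance Definition _ N := GRing.isMonoidMorphism.Build E E (shift N) (shiftM N).

Lemma degS_up N S : ~~ odd N -> degS (up N S) = degS S.
Proof.
move=> oN; rewrite /degS (permP (perm_up N S)) count_map; congr odd.
by apply: eq_count => x /=; rewrite oddD (negPf oN) addbF.
Qed.

Lemma Ehom_shift N g a : ~~ odd N -> Ehom g a -> Ehom g (shift N a).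
Proof.
move=> oN [[s as_] ag]; split=> [|S].
  exists [seq up N T | T <- s] => S /[dup] /shift_high NS; rewrite -(downK NS) shift_up.
  by move=> /as_ ?; rewrite map_f.
move=> /[dup] /shift_high NS; rewrite -(downK NS) shift_up degS_up //; exact: ag.
Qed.

End GrassmannMorphisms.

(** * Graded evaluations *)

Section WordSums.
Variable F : fieldType.
Local Notation word := (seq var).
Implicit Types (f p q : fpoly F) (u v w : word).

Lemma sum_delta (T : eqType) (s : seq T) x (h : T -> F) : uniq s ->
  (h x != 0 -> x \in s) -> \sum_(y <- s) (x == y)%:R * h y = h x.
Proof.
move=> us hx; have [xs|xs] := boolP (x \in s).
  rewrite (bigD1_seq x) //= eqxx mul1r big1 ?addr0 // => y /negPf.
  by rewrite eq_sym => ->; rewrite mul0r.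
rewrite big_seq big1 => [|y ys]; last by case: eqP xs ys => [->/negPf->//|_ _ _]; rewrite mul0r.
by apply/esym/eqP; apply: contraNT xs.
Qed.

(** Only the cut at position [size u] can contribute. This trades sums over the cuts of a word for
    independent sums over the two pieces. *)
Lemma sum_cut w u v :
  \sum_(i < (size w).+1) (take i w == u)%:R * (drop i w == v)%:R = (u ++ v == w)%:R :> F.
Proof.
transitivity (\sum_(i < (size w).+1) ((size u == i) && (u ++ v == w))%:R : F).
  apply: eq_bigr => i _; rewrite -natrM mulnb; congr (nat_of_bool _)%:R.
  apply/andP/andP => -[/eqP e1 /eqP e2].
    rewrite -e1 -e2 cat_take_drop eqxx size_takel ?eqxx //.
    by rewrite -ltnS ltn_ord.
  by rewrite -e1 -e2 take_size_cat // drop_size_cat // !eqxx.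
case: eqP => [<-|_]; last by rewrite big1 // => i _; rewrite andbF.
have hu : (size u < (size (u ++ v)).+1)%N by rewrite size_cat ltnS leq_addr.
rewrite (bigD1 (Ordinal hu)) //= eqxx big1 ?addr0 // => i.
by rewrite -val_eqE /= eq_sym => /negPf->.
Qed.

Lemma sum_cut_at x0 w u x v :
  \sum_(i < size w) ((nth x0 w i == x)%:R * ((take i w == u)%:R * (drop i.+1 w == v)%:R))
    = (u ++ x :: v == w)%:R :> F.
Proof.
transitivity (\sum_(i < size w) ((size u == i) && (u ++ x :: v == w))%:R : F).
  apply: eq_bigr => i _; rewrite -!natrM !mulnb; congr (nat_of_bool _)%:R.
  apply/and3P/andP => [[/eqP e1 /eqP e2 /eqP e3]|[/eqP e1 /eqP e2]].
    rewrite -e1 -e2 -e3 -drop_nth ?ltn_ord // cat_take_drop eqxx size_takel ?eqxx //.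
    by rewrite ltnW ?ltn_ord.
  by rewrite -e1 -e2 nth_cat ltnn subnn take_size_cat // -cat_rcons drop_size_cat ?size_rcons // !eqxx.
case: eqP => [<-|_]; last by rewrite big1 // => i _; rewrite andbF.
have hu : (size u < size (u ++ x :: v))%N by rewrite size_cat /= addnS ltnS leq_addr.
rewrite (bigD1 (Ordinal hu)) //= eqxx big1 ?addr0 // => i.
by rewrite -val_eqE /= eq_sym => /negPf->.
Qed.

Lemma pmulE p q s t w : uniq s -> uniq t ->
    (forall w, p w != 0 -> w \in s) -> (forall w, q w != 0 -> w \in t) ->
  pmul p q w = \sum_(u <- s) \sum_(v <- t) (u ++ v == w)%:R * (p u * q v).
Proof.
move=> us ut ps qt; rewrite /pmul.
under [RHS]eq_bigr do under eq_bigr do rewrite -sum_cut mulr_suml.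
under [RHS]eq_bigr do rewrite exchange_big /=.
rewrite exchange_big /=; apply: eq_bigr => i _.
rewrite -{1}(sum_delta us (ps (take i w))) mulr_suml; apply: eq_bigr => u _.
rewrite -{1}(sum_delta ut (qt (drop i w))) mulr_sumr; apply: eq_bigr => v _.
by rewrite mulrACA.
Qed.

Lemma pmul_pfin p q : pfin p -> pfin q -> pfin (pmul p q).
Proof.
move=> [s ps] [t qt]; exists [seq u ++ v | u <- s, v <- t] => w.
apply: contraNT => wst; rewrite /pmul big1 // => i _.
have [->|/ps us] := eqVneq (p (take i w)) 0; first by rewrite mul0r.
have [->|/qt vt] := eqVneq (q (drop i w)) 0; first by rewrite mulr0.
by case/negP: wst; apply/allpairsP; exists (take i w, drop i w); rewrite /= cat_take_drop.
Qed.

Lemma sum_pmul p q s t r l : uniq s -> uniq t -> uniq r ->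
    (forall w, p w != 0 -> w \in s) -> (forall w, q w != 0 -> w \in t) ->
    (forall w, pmul p q w != 0 -> w \in r) ->
  \sum_(w <- r) pmul p q w * l w = \sum_(u <- s) \sum_(v <- t) p u * q v * l (u ++ v).
Proof.
move=> us ut ur ps qt pqr.
pose r' := undup (r ++ [seq u ++ v | u <- s, v <- t]).
have ur' : uniq r' by exact: undup_uniq.
have pqr' w : pmul p q w * l w != 0 -> w \in r.
  by rewrite mulf_eq0 negb_or => /andP[/pqr].
rewrite (@sum_supp F _ r r') //; last first.
  by move=> w /pqr'; rewrite mem_undup mem_cat => ->.
under eq_bigr do rewrite (pmulE _ us ut ps qt) mulr_suml.
rewrite exchange_big /= big_seq [RHS]big_seq; apply: eq_bigr => u us'.
under eq_bigr do rewrite mulr_suml.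
rewrite exchange_big /= big_seq [RHS]big_seq; apply: eq_bigr => v vt'.
under eq_bigr do rewrite -mulrA.
rewrite (sum_delta (h := fun w => p u * q v * l w)) // => _.
by rewrite mem_undup mem_cat allpairs_f ?orbT.
Qed.

(** Regroups the pairing of [D_x] with [g (x) h] by the whole word [w = a x b]. The inner sum over
    positions of [x] has the shape of a corner entry in a product of block triangular matrices. *)
Lemma sum_cut_poly x0 f x (s t r : seq word) (g h : word -> F) :
    uniq s -> uniq t -> uniq r -> (forall w, f w != 0 -> w \in r) ->
    (forall a b, f (a ++ x :: b) != 0 -> a \in s /\ b \in t) ->
  \sum_(a <- s) \sum_(b <- t) f (a ++ x :: b) * g a * h b =
  \sum_(w <- r) f w *
    \sum_(i < size w) (nth x0 w i == x)%:R * (g (take i w) * h (drop i.+1 w)).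
Proof.
move=> us ut ur fr fst.
transitivity (\sum_(w <- r) f w * \sum_(a <- s) \sum_(b <- t)
   (a ++ x :: b == w)%:R * (g a * h b)).
  under [RHS]eq_bigr do rewrite mulr_sumr.
  rewrite [RHS]exchange_big /=; apply: eq_bigr => a _.
  under [RHS]eq_bigr do rewrite mulr_sumr.
  rewrite [RHS]exchange_big /=; apply: eq_bigr => b _.
  under [RHS]eq_bigr do rewrite mulrCA.
  rewrite (sum_delta (h := fun w => f w * (g a * h b))) ?mulrA //.
  by rewrite !mulf_eq0 !negb_or -andbA => /andP[/fr].
apply: eq_bigr => w _; have [->|fw] := eqVneq (f w) 0; first by rewrite !mul0r.
congr (_ * _).
under eq_bigr do under eq_bigr do rewrite -(sum_cut_at x0) mulr_suml.
under eq_bigr do rewrite exchange_big /=.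
rewrite exchange_big /=; apply: eq_bigr => i _.
have [nx|_] := eqVneq (nth x0 w i) x; last first.
  by rewrite mul0r big1 // => a _; rewrite big1 // => b _; rewrite !mul0r.
have wE : w = take i w ++ x :: drop i.+1 w.
  by rewrite -nx -drop_nth ?ltn_ord // cat_take_drop.
have [tis dit] : take i w \in s /\ drop i.+1 w \in t by apply: fst; rewrite -wE.
rewrite mul1r -(sum_delta us (fun _ => tis)) mulr_suml; apply: eq_bigr => a _.
rewrite -(sum_delta ut (fun _ => dit)) mulr_sumr; apply: eq_bigr => b _.
by rewrite mul1r mulrACA.
Qed.

End WordSums.

(** * Graded evaluations as linear functionals *)

Section Evaluations.
Variable F : fieldType.
Local Notation E := (grass F).
Local Notation word := (seq var).

(** The functionals reading one Grassmann coordinate of one matrix entry of a graded evaluation;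
    their orthogonal is the ideal of graded identities. *)
Definition evals n (hom : bool -> mat F n -> Prop) (l : word -> F) : Prop :=
  exists (A : var -> 'M[E]_n) i j S,
    (forall v, hom v.1 (ofmx (A v))) /\ l = (fun w => (\prod_(v <- w) A v) i j S).

Lemma gr_ids_ann n (hom : bool -> mat F n -> Prop) f :
  gr_ids hom f <-> ann (evals hom) f.
Proof.
split=> -[ff Hf]; split=> //.
  move=> l [A [i [j [S [hA ->]]]]] s fs.
  rewrite -[RHS](Hf (fun v => ofmx (A v)) hA s fs i j S); apply: eq_bigr => w _.
  by rewrite evalwE; under [in RHS]eq_bigr do rewrite ofmxK.
move=> phi hphi s fs i j S; rewrite /evalp.
under eq_bigr do rewrite evalwE.
apply: (Hf (fun w => (\prod_(v <- w) tomx (phi v)) i j S)) => //.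
by exists (fun v => tomx (phi v)), i, j, S; split=> // v; rewrite tomxK.
Qed.

Lemma mulmx_grassE m n p (A : 'M[E]_(m, n)) (B : 'M[E]_(n, p)) i j S :
  (A *m B) i j S = \sum_k \sum_(T <- fpowerset S)
     (-1) ^+ inv T (S `\` T) * A i k T * B k j (S `\` T).
Proof. by rewrite mxE grass_sumE. Qed.

(** A coordinate of the value at [w x] is a combination, with coefficients independent of [w], of
    coordinates of the value at [w] under the same substitution. *)
Lemma evals_rstable n (hom : bool -> mat F n -> Prop) : rstable (evals hom).
Proof.
move=> _ x p s [A [i [j [S [hA ->]]]]] Lp us ps.
have {Lp}p0 k T : \sum_(w <- s) p w * (\prod_(v <- w) A v) i k T = 0.
  by apply: ((annP _ us ps).1 Lp (fun w => _)); exists A, i, k, T.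
under eq_bigr do rewrite -cats1 big_cat big_seq1 mulmx_grassE mulr_sumr.
rewrite exchange_big big1 //= => k _.
under eq_bigr do rewrite mulr_sumr.
rewrite exchange_big big1 //= => T _.
transitivity ((\sum_(w <- s) p w * (\prod_(v <- w) A v) i k T) *
   ((-1) ^+ inv T (S `\` T) * A x k j (S `\` T))); last by rewrite p0 mul0r.
rewrite mulr_suml; apply: eq_bigr => w _.
by rewrite -!mulrA; congr (_ * _); rewrite mulrCA.
Qed.

Lemma evals_lstable n (hom : bool -> mat F n -> Prop) : lstable (evals hom).
Proof.
move=> _ x p s [A [i [j [S [hA ->]]]]] Lp us ps.
have {Lp}p0 k T : \sum_(w <- s) p w * (\prod_(v <- w) A v) k j T = 0.
  by apply: ((annP _ us ps).1 Lp (fun w => _)); exists A, k, j, T.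
under eq_bigr do rewrite big_cons mulmx_grassE mulr_sumr.
rewrite exchange_big big1 //= => k _.
under eq_bigr do rewrite mulr_sumr.
rewrite exchange_big big1 //= => T _.
transitivity ((-1) ^+ inv T (S `\` T) * A x i k T *
  (\sum_(w <- s) p w * (\prod_(v <- w) A v) k j (S `\` T))); last by rewrite p0 mulr0.
rewrite mulr_sumr; apply: eq_bigr => w _; exact: mulrCA.
Qed.

Lemma map_mx_prod n (h : {rmorphism E -> E}) (A : var -> 'M[E]_n) w :
  map_mx h (\prod_(v <- w) A v) = \prod_(v <- w) map_mx h (A v).
Proof.
elim: w => [|v w IH]; first by rewrite !big_nil map_mx1.
by rewrite !big_cons map_mxM IH.
Qed.

(** A path from the first block to the second crosses the corner exactly once, using [A] before the
    crossing and [B] after it. *)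
Lemma prod_block_mx d m (A : var -> 'M[E]_d) (U : var -> 'M[E]_(d, m))
    (B : var -> 'M[E]_m) x0 w :
  \prod_(v <- w) block_mx (A v) (U v) 0 (B v) =
  block_mx (\prod_(v <- w) A v)
    (\sum_(i < size w) (\prod_(v <- take i w) A v) *m U (nth x0 w i) *m
                       (\prod_(v <- drop i.+1 w) B v))
    0 (\prod_(v <- w) B v) :> 'M[E]_(d + m).
Proof.
elim: w => [|v w IH]; first by rewrite !big_nil big_ord0 -scalar_mx_block.
rewrite !big_cons IH -mulmxE mulmx_block !mulmx0 !mul0mx !addr0 add0r.
congr block_mx; rewrite big_ord_recl /= drop0 big_nil mul1mx addrC; congr (_ + _).
rewrite mulmx_sumr; apply: eq_bigr => i _.
by rewrite big_cons /= -mulmxE !mulmxA.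
Qed.

End Evaluations.

(** * Block triangular matrices *)

Section BlockTriangular.
Variable F : fieldType.
Local Notation E := (grass F).
Local Notation word := (seq var).
Variables (d : nat) (ds : seq nat).
Local Notation m := (sumn ds).
Local Notation LM := (evals (@Mhom F d)).
Local Notation LU := (evals (@UThom F ds)).
Local Notation LUT := (evals (@UThom F (d :: ds))).

Lemma blk_lshift i : (i < d)%N -> blk (d :: ds) i = 0%N.
Proof.
move=> id; apply/eqP; rewrite /blk -leqn0 leqNgt -has_count; apply/hasPn => r _.
by rewrite big_ord_recl /= -ltnNge (leq_trans id) // leq_addr.
Qed.

Lemma blk_rshift j : blk (d :: ds) (d + j) = (blk ds j).+1.
Proof.
rewrite /blk /= big_ord_recl big_ord0 addn0 leq_addr add1n; congr _.+1.
rewrite -add1n iotaDl count_map; apply: eq_count => r /=.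
by rewrite big_ord_recl /= leq_add2l.
Qed.

Lemma UThom_block g (A : 'M[E]_d) (U : 'M[E]_(d, m)) (B : 'M[E]_m) :
    Mhom g (ofmx A) -> (forall i j, Ehom g (U i j)) -> @UThom F ds g (ofmx B) ->
  @UThom F (d :: ds) g (ofmx (block_mx A U 0 B)).
Proof.
move=> hA hU [trB hB]; split=> [i j|i j]; rewrite /ofmx.
  case: (split_ordP i) => i' ->; case: (split_ordP j) => j' -> /=.
  - by rewrite !blk_lshift.
  - by rewrite blk_rshift (blk_lshift (ltn_ord i')).
  - by move=> _ S; rewrite block_mxEdl mxE.
  - by rewrite !blk_rshift ltnS => ij S; rewrite block_mxEdr; apply: trB.
case: (split_ordP i) => i' ->; case: (split_ordP j) => j' ->.
- by rewrite block_mxEul; apply: hA.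
- by rewrite block_mxEur; apply: hU.
- by rewrite block_mxEdl mxE; apply: Ehom0.
- by rewrite block_mxEdr; apply: hB.
Qed.

Lemma UThom_blockP g (A : 'M[E]_(d + m)) : @UThom F (d :: ds) g (ofmx A) ->
  [/\ Mhom g (ofmx (ulsubmx A)), @UThom F ds g (ofmx (drsubmx A)) & dlsubmx A = 0].
Proof.
move=> [trA hA]; split=> [i j||].
- by rewrite /ofmx !mxE; apply: hA.
- split=> [i j ij S|i j]; rewrite /ofmx !mxE; last exact: hA.
  by apply: trA; rewrite /= !blk_rshift ltnS.
- apply/matrixP => i j; rewrite !mxE; apply/funext => S.
  by apply: trA; rewrite /= blk_rshift blk_lshift.
Qed.

Lemma ann_pmul (p q : fpoly F) : ann LM p -> ann LU q -> ann LUT (pmul p q).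
Proof.
move=> Lp Lq; have [[s' ps'] _] := Lp; have [[t' qt'] _] := Lq.
have [s us ps] : exists2 s, uniq s & forall w, p w != 0 -> w \in s.
  by exists (undup s') => [|w /ps']; rewrite ?undup_uniq ?mem_undup.
have [t ut qt] : exists2 t, uniq t & forall w, q w != 0 -> w \in t.
  by exists (undup t') => [|w /qt']; rewrite ?undup_uniq ?mem_undup.
have [r' pqr'] := pmul_pfin (ex_intro _ s ps) (ex_intro _ t qt).
have [r ur pqr] : exists2 r, uniq r & forall w, pmul p q w != 0 -> w \in r.
  by exists (undup r') => [|w /pqr']; rewrite ?undup_uniq ?mem_undup.
apply/(annP _ ur pqr) => _ [A [i [j [S [hA ->]]]]].
pose P w := \prod_(v <- w) A v.
have PE w : P w = \prod_(v <- w) block_mx (ulsubmx (A v : 'M[E]_(d + m)))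
    (ursubmx (A v : 'M[E]_(d + m))) 0 (drsubmx (A v : 'M[E]_(d + m))).
  apply: eq_bigr => v _; rewrite -[LHS](@submxK _ d m d m).
  by have [_ _ ->] := UThom_blockP (hA v).
have x0 : var := (false, 0%N).
(* For an intermediate index [k] in the first block the [p] factor vanishes: its entry is an
   evaluation in the [d] by [d] block or lies below the diagonal blocks. For [k] in the second block
   the same holds of the [q] factor. *)
have P0 k : (forall T, \sum_(u <- s) p u * P u i k T = 0) \/
            (forall T, \sum_(v <- t) q v * P v k j T = 0).
  case: (@split_ordP d m k) => k' ->; [left|right] => T.
    case: (@split_ordP d m i) => i' ->.
      under eq_bigr do rewrite PE (prod_block_mx _ _ _ x0) block_mxEul.
      apply: ((annP _ us ps).1 Lp (fun w => _)).
      exists (fun v => ulsubmx (A v : 'M[E]_(d + m))), i', k', T; split=> // v.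
      by have [] := UThom_blockP (hA v).
    rewrite big1 // => u _.
    by rewrite PE (prod_block_mx _ _ _ x0) block_mxEdl mxE grass0E mulr0.
  case: (@split_ordP d m j) => j' ->.
    rewrite big1 // => u _.
    by rewrite PE (prod_block_mx _ _ _ x0) block_mxEdl mxE grass0E mulr0.
  under eq_bigr do rewrite PE (prod_block_mx _ _ _ x0) block_mxEdr.
  apply: ((annP _ ut qt).1 Lq (fun w => _)).
  exists (fun v => drsubmx (A v : 'M[E]_(d + m))), k', j', T; split=> // v.
  by have [] := UThom_blockP (hA v).
rewrite (sum_pmul _ us ut ur ps qt pqr).
transitivity (\sum_k \sum_(T <- fpowerset S) (-1) ^+ inv T (S `\` T) *
  ((\sum_(u <- s) p u * P u i k T) * (\sum_(v <- t) q v * P v k j (S `\` T)))).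
  under eq_bigr do under eq_bigr do rewrite big_cat mulmx_grassE mulr_sumr.
  under eq_bigr do rewrite exchange_big /=.
  rewrite exchange_big /=; apply: eq_bigr => k _.
  under eq_bigr do under eq_bigr do rewrite mulr_sumr.
  under eq_bigr do rewrite exchange_big /=.
  rewrite exchange_big /=; apply: eq_bigr => T _.
  rewrite mulr_suml mulr_sumr; apply: eq_bigr => u _.
  rewrite !mulr_sumr; apply: eq_bigr => v _.
  by rewrite -[X in _ * X = _]mulrA mulrCA mulrACA.
apply: big1 => k _; apply: big1 => T _.
by case: (P0 k) => ->; rewrite ?(mul0r, mulr0).
Qed.

Lemma ann_sum (L : (word -> F) -> Prop) (I : Type) (r : seq I) (g : I -> fpoly F) :
  (forall i, ann L (g i)) -> ann L (fun w => \sum_(i <- r) g i w).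
Proof.
move=> Lg; elim: r => [|i r IH].
  suff -> : (fun w => \sum_(i <- [::]) g i w) = fun=> 0 by exact: ann0.
  by apply/funext => w; rewrite big_nil.
suff -> : (fun w => \sum_(i <- i :: r) g i w) = fun w => g i w + \sum_(i <- r) g i w.
  exact: ann_add.
by apply/funext => w; rewrite big_cons.
Qed.

Lemma prodI_sub_UT f : prodI (ann LM) (ann LU) f -> ann LUT f.
Proof.
move=> [k [a [b [ab fE]]]].
suff -> : f = fun w => \sum_(r < k) pmul (a r) (b r) w.
  by apply: ann_sum => r; have [] := ab r; apply: ann_pmul.
by apply/funext.
Qed.

Lemma UThom0 g : @UThom F ds g (ofmx 0).
Proof. by split=> [i j _ S|i j]; rewrite /ofmx mxE //; apply: Ehom0. Qed.

Lemma Mhom0 n g : Mhom g (ofmx (0 : 'M[E]_n)).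
Proof. by move=> i j; rewrite /ofmx mxE; apply: Ehom0. Qed.

Lemma evals_block (A : var -> 'M[E]_d) (U : var -> 'M[E]_(d, m)) (B : var -> 'M[E]_m) i j S :
    (forall v, Mhom v.1 (ofmx (A v))) -> (forall v i j, Ehom v.1 (U v i j)) ->
    (forall v, @UThom F ds v.1 (ofmx (B v))) ->
  LUT (fun w => (\prod_(v <- w) (block_mx (A v) (U v) 0 (B v) : 'M[E]_(sumn (d :: ds)))) i j S).
Proof.
move=> hA hU hB; exists (fun v => block_mx (A v) (U v) 0 (B v)), i, j, S; split=> // v.
exact: UThom_block.
Qed.

(** A graded substitution into the first diagonal block extends by zero to the whole block
    triangular algebra. *)
Lemma UT_sub_M f : ann LUT f -> ann LM f.
Proof.
move=> [ff Lf]; split=> // _ [A [i [j [S [hA ->]]]]] s fs.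
pose B (v : var) : 'M[E]_m := 0; pose U (v : var) : 'M[E]_(d, m) := 0.
have hU v i' j' : Ehom v.1 (U v i' j') by rewrite mxE; apply: Ehom0.
have hB v : @UThom F ds v.1 (ofmx (B v)) by apply: UThom0.
rewrite -[RHS](Lf _ (@evals_block A U B (lshift m i) (lshift m j) S hA hU hB) s fs).
apply: eq_bigr => w _.
by rewrite (prod_block_mx _ _ _ (false, 0%N)) block_mxEul.
Qed.

Lemma UT_sub_UT f : ann LUT f -> ann LU f.
Proof.
move=> [ff Lf]; split=> // _ [B [i [j [S [hB ->]]]]] s fs.
pose A (v : var) : 'M[E]_d := 0; pose U (v : var) : 'M[E]_(d, m) := 0.
have hU v i' j' : Ehom v.1 (U v i' j') by rewrite mxE; apply: Ehom0.
have hA v : Mhom v.1 (ofmx (A v)) by apply: Mhom0.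
rewrite -[RHS](Lf _ (@evals_block A U B (rshift d i) (rshift d j) S hA hU hB) s fs).
apply: eq_bigr => w _.
by rewrite (prod_block_mx _ _ _ (false, 0%N)) block_mxEdr.
Qed.

(* Truncating [A] below [N], shifting [B] above [N + 1] and joining the two by
   the generator [e_N] or [e_(N+1)] of the degree of [x] makes the corner entry
   an element of a tensor product, whose coordinates factor. *)
Lemma UT_corner f x l1 l2 (s t : seq word) : ann LUT f -> LM l1 -> LU l2 ->
    uniq s -> uniq t ->
    (forall a b, f (a ++ x :: b) != 0 -> a \in s /\ b \in t) ->
  \sum_(a <- s) \sum_(b <- t) f (a ++ x :: b) * l1 a * l2 b = 0.
Proof.
move=> [[r' fr'] Lf] [A [i [j [S [hA ->]]]]] [B [k [l [T [hB ->]]]]] us ut fst.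
(* [N] exceeds every index in [S] and is even, so the generator of index [n = N + x.1] has the
   degree of [x]. [K = N + 2] is even, so shifting by it preserves degrees, and it exceeds [n],
   which is at most [N + 1]. *)
pose N := (\max_(y <- S) y).+1.*2.
have SN : all (fun y => y < N)%N S.
  apply/allP => y yS; rewrite /N -addnn; apply: leq_trans (leq_addr _ _).
  by rewrite ltnS; apply: leq_bigmax_seq.
have oN : odd N = false by rewrite odd_double.
pose n := (N + x.1)%N; pose K := N.+2.
have oK : ~~ odd K by rewrite /K -addn2 oddD oN.
have nx : odd n = x.1 by rewrite oddD oN addFb oddb.
pose e : E := egen F n.
pose A' v := map_mx (trunc N) (A v); pose B' v := map_mx (shift K) (B v).
(* One nonzero entry, for the variable [x] alone: the corner entry [(i, l)] then collects exactly
   the products of an [(i, j)] entry, [e] and a [(k, l)] entry. *)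
pose U v : 'M[E]_(d, m) :=
  \matrix_(p, q) if [&& v == x, p == j & q == k] then e else 0.
have hA' v : Mhom v.1 (ofmx (A' v)).
  by move=> p q; rewrite /ofmx mxE; apply: Ehom_trunc; apply: hA.
have hB' v : @UThom F ds v.1 (ofmx (B' v)).
  have [trB hB2] := hB v; split=> [p q pq Q|p q]; rewrite /ofmx mxE.
    rewrite (_ : B v p q = 0) ?rmorph0 //; apply/funext => R; exact: trB.
  by apply: Ehom_shift => //; apply: hB2.
have hU v p q : Ehom v.1 (U v p q).
  rewrite mxE; case: ifP => [/and3P[/eqP-> _ _]|_]; last exact: Ehom0.
  by rewrite -nx; apply: Ehom_egen.
(* The coordinate at [R] of such a product is the coordinate at [S] of the left factor times that at
   [T] of the unshifted right factor. *)
pose R := S `|` ([fset n] `|` up K T).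
pose x0 : var := (false, 0%N).
have fr w : f w != 0 -> w \in undup r' by move=> /fr'; rewrite mem_undup.
rewrite (sum_cut_poly x0 _ _ us ut (undup_uniq r') fr fst).
rewrite -[RHS](Lf _ (@evals_block A' U B' (lshift m i) (rshift d l) R hA' hU hB') r' fr').
apply: eq_bigr => w _; congr (_ * _).
rewrite (prod_block_mx _ _ _ x0) block_mxEur summxE grass_sumE.
apply: eq_bigr => c _; set P := \prod_(v <- take c w) _; set Q := \prod_(v <- drop _ w) _.
have PE : \prod_(v <- take c w) A' v = map_mx (trunc N) P by rewrite map_mx_prod.
have QE : \prod_(v <- drop c.+1 w) B' v = map_mx (shift K) Q by rewrite map_mx_prod.
rewrite PE QE.
have -> : (map_mx (trunc N) P *m U (nth x0 w c) *m map_mx (shift K) Q) i l =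
    if nth x0 w c == x then trunc N (P i j) * (e * shift K (Q k l)) else 0.
  rewrite mxE (bigD1 k) //= big1 => [|q qk]; last first.
    rewrite mxE big1 ?mul0r // => p _.
    by rewrite [U _ _ _]mxE (negPf qk) !andbF mulr0.
  rewrite addr0 !mxE (bigD1 j) //= big1 => [|p pj]; last first.
    by rewrite [U _ _ _]mxE (negPf pj) andbF mulr0.
  rewrite addr0 !mxE !eqxx !andbT; case: ifP => _; last by rewrite mulr0 mul0r.
  by rewrite mulrA.
case: ifP => _; last by rewrite mul0r.
have hK (a : E) : high n.+1 (shift K a).
  move=> V /shift_high; apply: sub_all => y; apply: leq_trans.
  by rewrite /n /K ltnS -addn1 leq_add2l; case: (x.1).
have hN : high N (e * shift K (Q k l)).
  apply: highM => V; first by move=> /egen_supp ->; apply/allP => y; rewrite inE => /eqP->; apply: leq_addr.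
  by move=> /hK; apply: sub_all => y; apply: leq_trans; rewrite /n ltnW // ltnS leq_addr.
rewrite (grass_mul_low_high (@trunc_low F N _) hN SN); last first.
  apply/allP => y; rewrite !inE => /orP[/eqP->|/(allP (all_up K T))]; first exact: leq_addr.
  by apply: leq_trans; rewrite /K ltnW.
(* The second separation is at [n + 1]: the joining generator lies below it and the shifted factor
   at or above it. *)
rewrite (@grass_mul_low_high F n.+1).
- by rewrite /e egenE !mul1r shift_up /trunc SN.
- by move=> V /egen_supp ->; apply/allP => y; rewrite inE => /eqP->.
- exact: hK.
- by apply/allP => y; rewrite inE => /eqP->.
- by have := hK (fun=> 1) (up K T); rewrite shift_up; apply; apply: oner_neq0.
Qed.

Theorem UT_cons f : T_UT (d :: ds) f <-> prodI (@T_M F d) (@T_UT F ds) f.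
Proof.
have prodE : prodI (@T_M F d) (@T_UT F ds) f <-> prodI (ann LM) (ann LU) f.
  by split=> -[k [a [b [ab fE]]]]; exists k, a, b; split=> // r;
    have [ar br] := ab r; split; apply/gr_ids_ann.
split=> [/gr_ids_ann Lf|/prodE/prodI_sub_UT/gr_ids_ann//].
apply/prodE/lewin.
- exact: evals_rstable.
- exact: evals_lstable.
- exact: UT_sub_M.
- exact: UT_sub_UT.
by move=> x l1 l2 s t; apply: UT_corner.
Qed.

End BlockTriangular.

(** With one block all block indices are zero, so the triangularity condition is vacuous. The matrix
    size [sumn [:: d]] is [d + 0], whence the transport along an equation [n = d]. *)
Lemma UT_single (F : fieldType) d (f : fpoly F) : T_UT [:: d] f <-> T_M d f.
Proof.
have homE n (e : n = d) g (A : mat F n) :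
    ((forall i j : 'I_n, (blk [:: d] j < blk [:: d] i)%N -> forall S, A i j S = 0)
      /\ Mhom g A) <-> Mhom g A.
  split=> [[]//|hA]; split=> // i j.
  by rewrite !blk_lshift -?e.
have Me n (e : n = d) : gr_ids (@Mhom F n) f <-> T_M d f by rewrite /T_M -e.
rewrite -(Me _ (addn0 d)); split=> -[ff Hf]; split=> // phi hphi; apply: Hf => v.
  exact/(homE _ (addn0 d)).
by have /(homE _ (addn0 d)) := hphi v.
Qed.

Theorem theorem7p1 (F : fieldType) (charF : [pchar F]%R =i pred0)
  (ds : seq nat) (ds_ne : ds <> [::]) (ds_pos : all (fun d => 0 < d)%N ds)
  (f : fpoly F) :
  T_UT ds f <-> prod_T_M ds f.
Proof.
elim: ds f ds_ne {charF ds_pos} => // d [|d' ds] IH f _; first exact: UT_single.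
(* The same decomposition into products serves on both sides; the induction hypothesis is applied to
   each right factor. *)
rewrite UT_cons /prod_T_M /=; split=> -[k [a [b [ab fE]]]]; exists k, a, b;
  by split=> // r; have [ar br] := ab r; split=> //; apply/IH.
Qed.
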